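(* Let $\mathcal{C}$ be a linear code of length $n$ over a prime field $\mathbb{F}_p$. Then the code ideal $I(\mathcal{C})$ is an elimination ideal of the generalized code ideal $I_+(\mathcal{C})\subseteq\mathbb{K}[\mathbf{x}]$. More precisely, for each $1\le i\le p-1$, regarding $I(\mathcal{C})$ as an ideal of $\mathbb{K}[\underline{\mathbf{x}}_i]$, where $\underline{\mathbf{x}}_i=(x_{1i},x_{2i},\dots,x_{ni})$, one has $$I(\mathcal{C})=I_+(\mathcal{C})\cap\mathbb{K}[\underline{\mathbf{x}}_i].$$
   Context: $\mathbb{K}$ is an arbitrary field, $p$ is a prime, $\alpha$ is a fixed primitive element of $\mathbb{F}_p$ (so $\mathbb{F}_p=\{0,\alpha,\alpha^2,\dots,\alpha^{p-1}=1\}$). A linear code of length $n$ is a linear subspace of $\mathbb{F}_p^n$. Variables: $\mathbf{x}=(\mathbf{x}_1,\dots,\mathbf{x}_n)$ with $\mathbf{x}_j=(x_{j1},\dots,x_{j,p-1})$, so $\mathbb{K}[\mathbf{x}]$ is the polynomial ring in the $n(p-1)$ variables $x_{ju}$, $1\le j\le n$, $1\le u\le p-1$. For each $i$, $\mathbb{K}[\underline{\mathbf{x}}_i]\subset\mathbb{K}[\mathbf{x}]$ is the polynomial subring in the $n$ variables $x_{1i},\dots,x_{ni}$. Code ideal: in the ring $\mathbb{K}[\underline{\mathbf{x}}_i]$ with $n$ variables, $$I(\mathcal{C})=\langle \underline{\mathbf{x}}_i^{a}-\underline{\mathbf{x}}_i^{b}\mid a,b\in\mathbb{F}_p^n,\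 a-b\in\mathcal{C}\rangle+\langle x_{ji}^p-1\mid 1\le j\le n\rangle,$$ where an exponent vector in $\mathbb{F}_p^n$ is read as an integer vector with entries in $\{0,\dots,p-1\}$ and $\underline{\mathbf{x}}_i^{a}=x_{1i}^{a_1}\cdots x_{ni}^{a_n}$. Crossing map: $\blacktriangle:\mathbb{F}_p^n\to\mathbb{Z}^{n(p-1)}$ sends $(a_1,\dots,a_n)$ to the concatenation of $n$ blocks of length $p-1$, where the $j$th block is the unit vector $\mathbf{e}_{u}$ if $a_j=\alpha^{u}$ with $1\le u\le p-1$, and the zero vector if $a_j=0$. Thus $\mathbf{x}^{\blacktriangle a}=\prod_{j:\,a_j=\alpha^{u_j}\neq0}x_{j,u_j}$. The ideal $I_q$ (here $q=p$) of $\mathbb{K}[\mathbf{x}]$ is generated, for all $1\le j\le n$ and $1\le u,v,w\le p-1$, by the binomials $x_{ju}x_{jv}-x_{jw}$ whenever $\alpha^u+\alpha^v=\alpha^w$, and $x_{ju}x_{jv}-1$ whenever $\alpha^u+\alpha^v=0$ ($u=v$ allowed). Generalized code ideal: $$I_+(\mathcal{C})=\langle\mathbf{x}^{\blacktriangle a}-\mathbf{x}^{\blacktriangle b}\mid a,b\in\mathbb{F}_p^n,\ a-b\in\mathcal{C}\rangle+I_q\subseteq\mathbb{K}[\mathbf{x}].$$ *)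

(* Defs.v *)
From mathcomp Require Import all_boot all_order all_algebra.
From mathcomp Require Import boolp classical_sets.
From mathcomp Require Import mpoly.

Set Implicit Arguments.
Unset Strict Implicit.
Unset Printing Implicit Defensive.

Import GRing.Theory.
Local Open Scope classical_set_scope.
Local Open Scope ring_scope.

(* Ideals are classical sets: MathComp's ideals (ring_quotient) are proper and
   boolean, with no generation operation. *)
Definition ideal_span (R : comNzRingType) (G : set R) : set R :=
  [set f | exists s : seq (R * R),
     (forall rg, rg \in s -> G rg.2) /\ f = \sum_(rg <- s) rg.1 * rg.2].

Definition ideal_sum (R : comNzRingType) (I J : set R) : set R :=
  [set f | exists g h, [/\ I g, J h & f = g + h]].

(* The index u : 'I_p.-1 is zero-based: it stands for the mathematical index
   u.+1 in {1, ..., p-1}.  The variable x_{j,u+1} of the ring K[x], which has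
   n(p-1) variables, is numbered by the pair (j, u) in row-major order. *)
Definition xvar (K : fieldType) (p n : nat) (j : 'I_n) (u : 'I_p.-1) :
    {mpoly K[n * p.-1]} :=
  'X_(mxvec_index j u).

(* The exponents are the representatives of the a_j in {0, ..., p-1}. *)
Definition expo (p n : nat) (a : 'rV['F_p]_n) : 'X_{1..n} :=
  [multinom (a ord0 j : nat) | j < n].

Definition code_ideal (K : fieldType) (p n : nat) (C : {vspace 'rV['F_p]_n}) :
    set {mpoly K[n]} :=
  ideal_sum
    (ideal_span [set f | exists a b : 'rV['F_p]_n,
       a - b \in C /\ f = 'X_[expo a] - 'X_[expo b]])
    (ideal_span [set f | exists j : 'I_n, f = 'X_j ^+ p - 1]).

Arguments code_ideal K {p n} C.

(* For alpha primitive, the j-th row of the matrix is the unit vector e_u if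
   a_j = alpha^u with 1 <= u <= p-1, and zero if a_j = 0. *)
Definition crossing (p n : nat) (alpha : 'F_p) (a : 'rV['F_p]_n) :
    'rV[nat]_(n * p.-1) :=
  mxvec (\matrix_(j < n, u < p.-1) (a ord0 j == alpha ^+ u.+1 : nat)).

Definition crossing_monomial (K : fieldType) (p n : nat) (alpha : 'F_p)
    (a : 'rV['F_p]_n) : {mpoly K[n * p.-1]} :=
  'X_[[multinom crossing alpha a ord0 k | k < n * p.-1]].

Arguments crossing_monomial K {p n} alpha a.

Definition Iq (K : fieldType) (p n : nat) (alpha : 'F_p) :
    set {mpoly K[n * p.-1]} :=
  ideal_span
    ([set f | exists (j : 'I_n) (u v w : 'I_p.-1),
        alpha ^+ u.+1 + alpha ^+ v.+1 = alpha ^+ w.+1 /\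
        f = xvar K j u * xvar K j v - xvar K j w] `|`
     [set f | exists (j : 'I_n) (u v : 'I_p.-1),
        alpha ^+ u.+1 + alpha ^+ v.+1 = 0 /\
        f = xvar K j u * xvar K j v - 1]).

Arguments Iq K {p} n alpha.

Definition gen_code_ideal (K : fieldType) (p n : nat) (alpha : 'F_p)
    (C : {vspace 'rV['F_p]_n}) : set {mpoly K[n * p.-1]} :=
  ideal_sum
    (ideal_span [set f | exists a b : 'rV['F_p]_n,
       a - b \in C /\
       f = crossing_monomial K alpha a - crossing_monomial K alpha b])
    (Iq K n alpha).

Arguments gen_code_ideal K {p n} alpha C.

(* The polynomials of K[x] in which only x_{1,i+1}, ..., x_{n,i+1} occur. *)
Definition subring_xi (K : fieldType) (p n : nat) (i : 'I_p.-1) :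
    set {mpoly K[n * p.-1]} :=
  [set f | forall m, m \in msupp f ->
     forall (j : 'I_n) (u : 'I_p.-1), u != i -> m (mxvec_index j u) = 0%N].

(* A polynomial in n variables regarded as an element of K[x] by sending its
   j-th variable to x_{j,i+1}. *)
Definition embed_xi (K : fieldType) (p n : nat) (i : 'I_p.-1)
    (f : {mpoly K[n]}) : {mpoly K[n * p.-1]} :=
  f \mPo [tuple xvar K j i | j < n].

(* Main.v *)
Require Import Defs.
From mathcomp Require Import all_boot all_order all_algebra finfield.
From mathcomp Require Import boolp classical_sets.
From mathcomp Require Import mpoly.

Import GRing.Theory.
Local Open Scope classical_set_scope.
Local Open Scope ring_scope.

(** Modulo [Iq], the variable x_{j,u} stands for the element alpha^u of the
    j-th copy of the additive group of 'F_p: the relations say exactly that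
    multiplying variables adds the field elements.  With beta = alpha^i, a
    generator of that cyclic group, one power of the single variable x_{j,i}
    represents each element, and this gives the two inclusions.  Here and below,
    prose indices u and i range over 1, ..., p-1, hence are the successors of
    the corresponding ordinals, and y_j is the j-th variable of the small ring.

    Left to right: x_{j,i}^k is congruent to the variable standing for
    k * beta ([xvar_exp]), so the embedding sends y^a to the crossing monomial
    of beta * a modulo [Iq] ([embed_monomial]).  Since C is stable under
    scaling by beta, generators of the code ideal land in the generalized code
    ideal ([embed_code_ideal]).

    Right to left: the substitution [contract] of y_j^c for x_{j,u}, where c in
    {0, ..., p-1} represents alpha^u / beta, is a ring morphism that inverts the
    embedding on K[x_{1i}, ..., x_{ni}] ([contractK]).  It sends the crossing
    monomial of a to the monomial of a / beta ([contract_crossing]) and the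
    relations of [Iq] to differences of powers of y_j with exponents congruent
    modulo p; hence it maps the generalized code ideal into the code ideal
    ([contract_gen_code_ideal]).  An element f of the intersection is then the
    embedding of [contract f], which lies in the code ideal. *)

(** * Ideals given as sets *)

Definition is_ideal {R : comNzRingType} (I : set R) :=
  [/\ I 0, forall f g, I f -> I g -> I (f + g) & forall h f, I f -> I (h * f)].

Lemma ideal_span_is_ideal {R : comNzRingType} (G : set R) :
  is_ideal (ideal_span G).
Proof.
split=> [|f g [s [sG ->]] [t [tG ->]]|h f [s [sG ->]]].
- by exists [::]; rewrite big_nil; split.
- exists (s ++ t); rewrite big_cat; split=> // rg.
  by rewrite mem_cat => /orP[/sG|/tG].
- exists [seq (h * rg.1, rg.2) | rg <- s]; split.
    by move=> _ /mapP[rg /sG rgG ->].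
  by rewrite big_map mulr_sumr; apply: eq_bigr => rg _; rewrite mulrA.
Qed.

Lemma ideal_span_gen {R : comNzRingType} (G : set R) f : G f -> ideal_span G f.
Proof.
move=> Gf; exists [:: (1, f)]; rewrite big_seq1 mul1r; split=> // rg.
by rewrite inE => /eqP->.
Qed.

Lemma ideal_span_min {R : comNzRingType} (G I : set R) :
  is_ideal I -> G `<=` I -> ideal_span G `<=` I.
Proof.
move=> [I0 ID IM] GI _ [s [sG ->]]; rewrite big_seq.
by apply: (big_ind I) => // rg /sG/GI; apply: IM.
Qed.

Lemma ideal_sum_is_ideal {R : comNzRingType} (I J : set R) :
  is_ideal I -> is_ideal J -> is_ideal (ideal_sum I J).
Proof.
move=> [I0 ID IM] [J0 JD JM]; split.
- by exists 0, 0; rewrite addr0.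
- move=> _ _ [f [g [If Jg ->]]] [f' [g' [If' Jg' ->]]].
  by exists (f + f'), (g + g'); rewrite addrACA; split; [apply: ID|apply: JD|].
- move=> h _ [f [g [If Jg ->]]].
  by exists (h * f), (h * g); rewrite mulrDr; split; [apply: IM|apply: JM|].
Qed.

Lemma ideal_sum_l {R : comNzRingType} (I J : set R) :
  is_ideal J -> I `<=` ideal_sum I J.
Proof. by move=> [J0 _ _] f If; exists f, 0; rewrite addr0. Qed.

Lemma ideal_sum_r {R : comNzRingType} (I J : set R) :
  is_ideal I -> J `<=` ideal_sum I J.
Proof. by move=> [I0 _ _] f Jf; exists 0, f; rewrite add0r. Qed.

Lemma ideal_sum_min {R : comNzRingType} (I J L : set R) :
  is_ideal L -> I `<=` L -> J `<=` L -> ideal_sum I J `<=` L.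
Proof. by move=> [_ LD _] IL JL _ [f [g [/IL Lf /JL Lg ->]]]; apply: LD. Qed.

Lemma preimage_is_ideal {R S : comNzRingType} (phi : {rmorphism R -> S})
    (I : set S) :
  is_ideal I -> is_ideal (phi @^-1` I).
Proof.
move=> [I0 ID IM]; split; rewrite /preimage /=.
- by rewrite rmorph0.
- by move=> f g If Ig; rewrite rmorphD; apply: ID.
- by move=> h f If; rewrite rmorphM; apply: IM.
Qed.

Lemma ideal_opp {R : comNzRingType} (I : set R) f :
  is_ideal I -> I f -> I (- f).
Proof. by move=> [_ _ IM] If; rewrite -mulN1r; apply: IM. Qed.

(** * Congruence modulo an ideal *)

Section Congruence.

Context {R : comNzRingType} {I : set R}.
Hypothesis idealI : is_ideal I.

Lemma cong_refl f : I (f - f).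
Proof. by rewrite subrr; case: idealI. Qed.

Lemma cong_trans g f h : I (f - g) -> I (g - h) -> I (f - h).
Proof.
have [_ ID _] := idealI.
by move=> Ifg Igh; rewrite -[f](subrK g) -addrA; apply: ID.
Qed.

Lemma cong_sym f g : I (f - g) -> I (g - f).
Proof. by move/(ideal_opp _ _ idealI); rewrite opprB. Qed.

Lemma congM f f' g g' : I (f - f') -> I (g - g') -> I (f * g - f' * g').
Proof.
have [_ ID IM] := idealI; move=> If Ig.
have -> : f * g - f' * g' = g * (f - f') + f' * (g - g').
  by rewrite !mulrBr addrA ![g * _]mulrC subrK.
by apply: ID; apply: IM.
Qed.

Lemma cong_prod {T : finType} (F G : T -> R) :
  (forall t, I (F t - G t)) -> I (\prod_t F t - \prod_t G t).
Proof.
move=> FG; apply: (big_rec2 (fun f g => I (f - g))) => [|t f g _].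
  exact: cong_refl.
exact: congM.
Qed.

Lemma congX f g k : I (f - g) -> I (f ^+ k - g ^+ k).
Proof.
move=> fg; elim: k => [|k IHk]; first by rewrite !expr0; apply: cong_refl.
by rewrite !exprS; apply: congM.
Qed.

(** Modulo f^p - 1, an exponent of f only matters through its residue. *)
Lemma cong_exp_mod f p k l :
  I (f ^+ p - 1) -> k = l %[mod p] -> I (f ^+ k - f ^+ l).
Proof.
move=> fp1 kl.
have redp m : I (f ^+ m - f ^+ (m %% p)).
  rewrite {1}(divn_eq m p) exprD mulnC exprM -[f ^+ (m %% p) in X in _ - X]mul1r.
  apply: congM; last exact: cong_refl.
  by rewrite -(expr1n _ (m %/ p)); apply: congX.
by apply: cong_trans (redp k) _; rewrite kl; apply/cong_sym/redp.
Qed.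

End Congruence.

(** * Arithmetic of 'F_p *)

Lemma Fp_val_add {p : nat} (p_prime : prime p) (s t : 'F_p) :
  ((s + t)%R : nat) = (s + t)%N %[mod p].
Proof.
have modn_eq M m : M = p -> m %% M = m %[mod p] by move=> ->; rewrite modn_mod.
exact: modn_eq (Fp_cast p_prime).
Qed.

(** Every nonzero s satisfies s^(p-1) = 1, hence is a power of a primitive
    (p-1)-th root of unity. *)
Lemma Fp_primitive_log {p : nat} (p_prime : prime p) {alpha : 'F_p} :
  (p.-1).-primitive_root alpha ->
  forall s, s != 0 -> exists u : 'I_p.-1, s = alpha ^+ u.+1.
Proof.
move=> prim s s0.
have unitX (t : 'F_p) : t != 0 -> t ^+ p.-1 = 1.
  move=> t0; apply: (mulfI t0).
  by have := expf_card t; rewrite card_Fp // mulr1 -exprS prednK ?prime_gt0.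
have alpha0 : alpha != 0.
  by rewrite (prim_root_eq0 prim) -lt0n (prim_order_gt0 prim).
(* dividing by alpha shifts the exponents 0, ..., p-2 to 1, ..., p-1 *)
have [|u def_s] := prim_rootP prim (x := s / alpha).
  by rewrite unitX // mulf_neq0 ?invr_eq0.
by exists u; rewrite exprSr -def_s divfK.
Qed.

(** * Monomials in the variables x_{j,u} *)

(** The variables of K[x] are numbered by pairs (j, u) in row-major order; this
    factors a monomial block by block. *)
Lemma mpolyX_mxvec {R : comNzRingType} {n q : nat} (m : 'X_{1..n * q}) :
  'X_[R, m] =
    \prod_(j < n) \prod_(u < q) 'X_(mxvec_index j u) ^+ m (mxvec_index j u).
Proof.
rewrite mpolyXE_id (reindex _ (curry_mxvec_bij n q)) /= pair_bigA /=.
by apply: eq_bigr => -[j u] _.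
Qed.

Section CodeIdeals.

Context (K : fieldType) {p : nat} (p_prime : prime p) {alpha : 'F_p}.
Context (alpha_prim : (p.-1).-primitive_root alpha) {n : nat}.

Let alphaX_neq0 k : alpha ^+ k != 0.
Proof.
by rewrite expf_neq0 // (prim_root_eq0 alpha_prim) -lt0n
           (prim_order_gt0 alpha_prim).
Qed.

Let alphaX_inj (u v : 'I_p.-1) : (alpha ^+ u.+1 == alpha ^+ v.+1) = (u == v).
Proof.
rewrite !exprS (inj_eq (mulfI _)); last by rewrite -(expr1 alpha).
by rewrite (eq_prim_root_expr alpha_prim) !modn_small.
Qed.

(** The monomial standing for a field element in block j: 1 for the element 0
    and x_{j,u} for alpha^u.  The product form is the one in which the crossing
    monomial factors. *)
Definition xelt (j : 'I_n) (s : 'F_p) : {mpoly K[n * p.-1]} :=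
  \prod_(u < p.-1) xvar K j u ^+ (s == alpha ^+ u.+1).

Lemma xelt0 j : xelt j 0 = 1.
Proof.
by apply: big1 => u _; rewrite eq_sym (negPf (alphaX_neq0 _)) expr0.
Qed.

Lemma xelt_exp j (u : 'I_p.-1) : xelt j (alpha ^+ u.+1) = xvar K j u.
Proof.
rewrite /xelt (bigD1 u) //= eqxx expr1 big1 ?mulr1 // => v vu.
by rewrite alphaX_inj eq_sym (negPf vu) expr0.
Qed.

Lemma crossing_monomialE a :
  crossing_monomial K alpha a = \prod_(j < n) xelt j (a ord0 j).
Proof.
rewrite /crossing_monomial mpolyX_mxvec; apply: eq_bigr => j _.
by apply: eq_bigr => u _; rewrite mnmE /crossing mxvecE mxE.
Qed.

Let ideal_Iq : is_ideal (Iq K n alpha).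
Proof. exact: ideal_span_is_ideal. Qed.

(** The relations of [Iq] only involve nonzero field elements, but they make
    the monomials standing for arbitrary field elements multiply as the
    elements add. *)
Lemma xelt_mul j s t : Iq K n alpha (xelt j s * xelt j t - xelt j (s + t)).
Proof.
have [->|s0] := eqVneq s 0.
  by rewrite xelt0 mul1r add0r; apply: cong_refl.
have [->|t0] := eqVneq t 0.
  by rewrite xelt0 mulr1 addr0; apply: cong_refl.
have [u def_s] := Fp_primitive_log p_prime alpha_prim _ s0.
have [v def_t] := Fp_primitive_log p_prime alpha_prim _ t0.
apply: ideal_span_gen; rewrite def_s def_t !xelt_exp.
have [st0|st0] := eqVneq (alpha ^+ u.+1 + alpha ^+ v.+1) 0.
  by right; exists j, u, v; rewrite st0 xelt0.
have [w def_st] := Fp_primitive_log p_prime alpha_prim _ st0.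
by left; exists j, u, v, w; rewrite def_st xelt_exp.
Qed.

(** x_{j,u} stands for alpha^u, so its k-th power stands for k * alpha^u; for
    k = p this gives x_{j,u}^p = 1 modulo [Iq]. *)
Lemma xvar_exp j (u : 'I_p.-1) k :
  Iq K n alpha (xvar K j u ^+ k - xelt j (alpha ^+ u.+1 *+ k)).
Proof.
elim: k => [|k IHk]; first by rewrite expr0 mulr0n xelt0; apply: cong_refl.
rewrite exprS mulrS; apply: (cong_trans ideal_Iq) (xelt_mul _ _ _).
by apply: congM => //; rewrite xelt_exp; apply: cong_refl.
Qed.

Let ideal_gen C : is_ideal (gen_code_ideal K alpha (n := n) C).
Proof.
by apply: ideal_sum_is_ideal => //; apply: ideal_span_is_ideal.
Qed.

Let ideal_code C : is_ideal (code_ideal K (p := p) (n := n) C).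
Proof. by apply: ideal_sum_is_ideal; apply: ideal_span_is_ideal. Qed.

Lemma Iq_gen_code_ideal C :
  Iq K n alpha `<=` gen_code_ideal K alpha (n := n) C.
Proof. by apply: ideal_sum_r; apply: ideal_span_is_ideal. Qed.

Lemma crossing_gen_code_ideal (C : {vspace 'rV['F_p]_n}) a b : a - b \in C ->
  gen_code_ideal K alpha C
    (crossing_monomial K alpha a - crossing_monomial K alpha b).
Proof.
by move=> Cab; apply: ideal_sum_l => //; apply: ideal_span_gen; exists a, b.
Qed.

Context (i : 'I_p.-1).

(** * The embedding maps the code ideal into the generalized code ideal *)

Lemma embed_xi_var (j : 'I_n) : embed_xi i 'X_j = xvar K j i.
Proof. by rewrite /embed_xi comp_mpolyXU -tnth_nth tnth_mktuple. Qed.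

Lemma embed_xi_mpolyX (m : 'X_{1..n}) :
  embed_xi i 'X_[K, m] = \prod_(j < n) xvar K j i ^+ m j.
Proof.
by rewrite /embed_xi comp_mpolyX; apply: eq_bigr => j _; rewrite tnth_mktuple.
Qed.

(** The factor x_{j,i}^(a_j) stands for a_j * alpha^i, which is the j-th entry
    of the scaled vector. *)
Lemma embed_monomial (a : 'rV['F_p]_n) :
  Iq K n alpha (embed_xi i 'X_[expo a]
                - crossing_monomial K alpha (alpha ^+ i.+1 *: a)).
Proof.
rewrite embed_xi_mpolyX crossing_monomialE; apply: cong_prod => // j.
have := xvar_exp j i (a ord0 j : nat).
by rewrite mnmE mxE -mulr_natr natr_Zp.
Qed.

Lemma embed_code_ideal (C : {vspace 'rV['F_p]_n}) :
  code_ideal K C `<=` embed_xi i @^-1` gen_code_ideal K alpha C.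
Proof.
have gen_preim : is_ideal (embed_xi i @^-1` gen_code_ideal K alpha C).
  exact: (preimage_is_ideal (comp_mpoly [tuple xvar K j i | j < n])).
apply: ideal_sum_min => //; apply: ideal_span_min => // f.
- move=> [a [b [Cab ->]]]; rewrite /preimage /=.
  have toC c := Iq_gen_code_ideal C _ (embed_monomial c).
  rewrite /embed_xi rmorphB /=.
  apply: cong_trans (toC a) _ => //.
  apply: cong_trans (cong_sym (ideal_gen C) _ _ (toC b)) => //.
  by apply: crossing_gen_code_ideal; rewrite -scalerBr memvZ.
- move=> [j ->]; rewrite /preimage /=; apply: Iq_gen_code_ideal.
  have := xvar_exp j i p.
  rewrite -mulr_natr pchar_Fp_0 // mulr0 xelt0.
  by rewrite /embed_xi rmorphB rmorph1 rmorphXn -embed_xi_var.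
Qed.

(** The support of a sum of monomials is contained in the set of these
    monomials, and the embedding of a monomial avoids the variables x_{j,u}
    with u different from i. *)
Lemma embed_subring_xi (f : {mpoly K[n]}) : subring_xi i (embed_xi i f).
Proof.
move=> m; rewrite mcoeff_msupp /embed_xi comp_mpolyEX linear_sum /= => m_f j u ui.
apply: contraNeq m_f => m_ju.
rewrite big1 // => m' _; rewrite mcoeffZ.
have -> : 'X_[m'] \mPo [tuple xvar K j i | j < n] =
    'X_[[multinom mxvec (\matrix_(j < n, u < p.-1) (m' j * (u == i))%N) ord0 k
        | k < n * p.-1]].
  rewrite [LHS]embed_xi_mpolyX mpolyX_mxvec; apply: eq_bigr => k _.
  rewrite (bigD1 i) //= big1 => [|v vi].
    by rewrite mulr1 mnmE mxvecE mxE eqxx muln1.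
  by rewrite mnmE mxvecE mxE (negPf vi) muln0.
rewrite mcoeffX; case: eqP => [def_m|]; last by rewrite mulr0.
by move: m_ju; rewrite -def_m mnmE mxvecE mxE (negPf ui) muln0.
Qed.

(** * The contraction of the generalized code ideal to the code ideal *)

(** The least c with c * alpha^i = s.  As y_j stands for alpha^i, this is the
    exponent of y_j that stands for s. *)
Definition contract_exp (s : 'F_p) : nat := (s / alpha ^+ i.+1)%R.

Definition contract (f : {mpoly K[n * p.-1]}) : {mpoly K[n]} :=
  f \mPo [tuple mxvec (\matrix_(j < n, u < p.-1)
                         'X_j ^+ contract_exp (alpha ^+ u.+1)) ord0 k
         | k < n * p.-1].

Lemma contract_var (j : 'I_n) (u : 'I_p.-1) :
  contract (xvar K j u) = 'X_j ^+ contract_exp (alpha ^+ u.+1).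
Proof.
by rewrite /contract comp_mpolyXU -tnth_nth tnth_mktuple mxvecE mxE.
Qed.

Lemma contract_exp0 : contract_exp 0 = 0%N.
Proof. by rewrite /contract_exp mul0r. Qed.

Lemma contract_exp_id : contract_exp (alpha ^+ i.+1) = 1%N.
Proof. by rewrite /contract_exp divff. Qed.

Lemma contract_expD s t :
  (contract_exp s + contract_exp t)%N = contract_exp (s + t) %[mod p].
Proof. by rewrite /contract_exp mulrDl Fp_val_add. Qed.

Lemma contract_xelt j s : contract (xelt j s) = 'X_j ^+ contract_exp s.
Proof.
have [->|s0] := eqVneq s 0.
  by rewrite xelt0 /contract rmorph1 contract_exp0 expr0.
have [u ->] := Fp_primitive_log p_prime alpha_prim _ s0.
by rewrite xelt_exp contract_var.
Qed.

(** An equality of monomials and not just a congruence: the exponents produced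
    by [contract_exp] are already reduced modulo p. *)
Lemma contract_crossing a :
  contract (crossing_monomial K alpha a) =
    'X_[expo ((alpha ^+ i.+1)^-1 *: a)].
Proof.
rewrite crossing_monomialE /contract rmorph_prod mpolyXE_id.
apply: eq_bigr => j _; rewrite [LHS]contract_xelt /contract_exp.
by rewrite mnmE mxE mulrC.
Qed.

Lemma contract_gen_code_ideal (C : {vspace 'rV['F_p]_n}) :
  gen_code_ideal K alpha C `<=` contract @^-1` code_ideal K C.
Proof.
have code_preim : is_ideal (contract @^-1` code_ideal K C).
  exact: (preimage_is_ideal (comp_mpoly _)).
have Xp1 j : code_ideal K C ('X_j ^+ p - 1).
  apply: ideal_sum_r; first exact: ideal_span_is_ideal.
  by apply: ideal_span_gen; exists j.
apply: ideal_sum_min => //; apply: ideal_span_min => // f.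
- move=> [a [b [Cab ->]]]; rewrite /preimage /=.
  rewrite /contract rmorphB /= -!/(contract _) !contract_crossing.
  apply: ideal_sum_l; first exact: ideal_span_is_ideal.
  apply: ideal_span_gen.
  exists ((alpha ^+ i.+1)^-1 *: a), ((alpha ^+ i.+1)^-1 *: b).
  by rewrite -scalerBr memvZ.
- case=> [[j [u [v [w [uvw ->]]]]]|[j [u [v [uv0 ->]]]]]; rewrite /preimage /=.
    rewrite /contract rmorphB rmorphM /= -!/(contract _) !contract_var -exprD.
    by apply: cong_exp_mod (Xp1 j) _ => //; rewrite contract_expD uvw.
  rewrite /contract rmorphB rmorphM rmorph1 /= -!/(contract _) !contract_var.
  rewrite -exprD -(expr0 'X_j).
  by apply: cong_exp_mod (Xp1 j) _ => //; rewrite contract_expD uv0 contract_exp0.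
Qed.

(** Only the variables x_{j,i} occur in f, and [contract] sends x_{j,i} to y_j
    itself because [contract_exp (alpha ^+ i.+1)] is exactly 1. *)
Lemma contractK f : subring_xi i f -> embed_xi i (contract f) = f.
Proof.
move=> f_xi; rewrite [RHS]mpolyE /contract comp_mpolyEX /embed_xi linear_sum /=.
apply: eq_big_seq => m /f_xi m_xi; rewrite linearZ /=; congr (_ *: _).
rewrite mpolyX_mxvec !rmorph_prod; apply: eq_bigr => j _.
rewrite (bigD1 i) //= big1 => [|u /(m_xi j)->]; last exact: expr0.
rewrite mulr1 !rmorphXn /=; congr (_ ^+ _).
by rewrite -/(xvar K j i) -/(contract _) contract_var contract_exp_id expr1
           [LHS]embed_xi_var.
Qed.

End CodeIdeals.

Theorem proposition4p4 (K : fieldType) (p : nat) (p_prime : prime p)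
    (alpha : 'F_p) (alpha_prim : (p.-1).-primitive_root alpha)
    (n : nat) (C : {vspace 'rV['F_p]_n}) (i : 'I_p.-1) :
  embed_xi i @` code_ideal K C = gen_code_ideal K alpha C `&` subring_xi i.
Proof.
apply/seteqP; split=> [_ [f Cf <-]|f [Cf f_xi]].
  by split; [apply: embed_code_ideal | apply: embed_subring_xi].
exists (contract K (alpha := alpha) i f); last exact: contractK.
exact: contract_gen_code_ideal Cf.
Qed.
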